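(* Let $X$ be a $k$-distance set on $S^{d-1}$. Define the polynomial of degree $k$ $$F_X(t):=\prod_{\alpha\in A_{\mathrm{inn}}(X)}(t-\alpha)=\sum_{i=0}^k f_i\,G_i^{(d)}(t),$$ where the $f_i$ are real numbers (the coefficients of the Gegenbauer expansion). Then $$|X|\le\sum_{i\ \text{with}\ f_i>0}h_i,$$ where the summation is over those $i$ with $0\le i\le k$ satisfying $f_i>0$, and $h_i=\dim \mathrm{Harm}_i(\mathbb{R}^d)$.
   Context: $S^{d-1}$ is the unit sphere in $\mathbb{R}^d$. A subset $X\subset\mathbb{R}^d$ is a $k$-distance set if there are exactly $k$ distinct Euclidean distances between two distinct points of $X$. With $(\cdot,\cdot)$ the standard inner product, $A_{\mathrm{inn}}(X)=\{(x,y): x,y\in X,\ x\neq y\}$ (for $X\subset S^{d-1}$ a $k$-distance set, this has exactly $k$ elements). $\mathrm{Harm}_i(\mathbb{R}^d)$ is the linear space of real harmonic homogeneous polynomials of degree $i$ in $d$ variables. The Gegenbauer polynomials $G_l^{(d)}(t)$, of degree $l$, are defined by $G_0^{(d)}(t)=1$, $G_1^{(d)}(t)=d\,t$ and $tG_l^{(d)}(t)=\lambda_{l+1}G_{l+1}^{(d)}(t)+(1-\lambda_{l-1})G_{l-1}^{(d)}(t)$ for $l\ge1$, where $\lambda_l=\frac{l}{d+2l-2}$ (with $\lambda_0=0$). *)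

(* Defs.v *)
From HB Require Import structures.
From mathcomp Require Import all_boot all_order all_algebra finmap.
From mathcomp Require Import mpoly.
From mathcomp Require Import boolp classical_sets functions cardinality reals.

Set Implicit Arguments.
Unset Strict Implicit.
Unset Printing Implicit Defensive.

Import Order.TTheory GRing.Theory Num.Theory.
Local Open Scope classical_set_scope.
Local Open Scope ring_scope.

Section Euclidean.
Context (R : realType) (d : nat).
Implicit Types (x y : 'rV[R]_d) (X : set 'rV[R]_d).

Definition inner x y : R := \sum_(i < d) x 0 i * y 0 i.

(* MathComp-Analysis norms row vectors by the maximum norm, hence a separate
   Euclidean norm *)
Definition enorm x : R := Num.sqrt (inner x x).

Definition edist x y : R := enorm (x - y).

Definition usphere : set 'rV[R]_d := [set x | enorm x = 1].

Definition distances X : set R :=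
  [set r | exists x y, [/\ X x, X y, x <> y & r = edist x y]].

Definition inner_products X : set R :=
  [set a | exists x y, [/\ X x, X y, x <> y & a = inner x y]].

Definition k_distance_set (k : nat) X : Prop := (distances X #= `I_k)%card.

(* [fset_set] enumerates a finite set; [inner_products X] is finite whenever X
   is a k-distance set on the sphere, by [inner_products_card] below *)
Definition annihilator X : {poly R} :=
  \prod_(a <- fset_set (inner_products X)) ('X - a%:P).

Lemma inner_products_card k X :
  X `<=` usphere -> k_distance_set k X -> (inner_products X #= `I_k)%card.
Proof.
have innerN x : X `<=` usphere -> X x -> inner x x = 1.
  move=> sX /sX; rewrite /usphere /enorm /= => nx.
  have i0 : 0 <= inner x x.
    by apply: sumr_ge0 => i _; rewrite -expr2 sqr_ge0.
  by rewrite -(sqr_sqrtr i0) nx expr1n.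
move=> sX kX.
have subE x y : X x -> X y -> inner (x - y) (x - y) = 2 - inner x y *+ 2.
  move=> Xx Xy; rewrite -[2]/(1 + 1) -{1}(innerN x) // -(innerN y) //.
  rewrite /inner -sumrMnl -!big_split -sumrB /=; apply: eq_bigr => i _.
  by rewrite !mxE -!expr2 sqrrB addrAC.
have i0 x : 0 <= inner x x by apply: sumr_ge0 => i _; rewrite -expr2 sqr_ge0.
have -> : inner_products X = (fun r => 1 - r ^+ 2 / 2) @` distances X.
  have e x y : X x -> X y -> inner x y = 1 - edist x y ^+ 2 / 2.
    move=> Xx Xy; rewrite /edist /enorm sqr_sqrtr // subE //.
    rewrite mulrBl divff ?pnatr_eq0 // -[inner x y *+ 2]mulr_natr.
    by rewrite mulfK ?pnatr_eq0 // subKr.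
  apply/seteqP; split=> [_ [x [y [Xx Xy xy ->]]]|_ [_ [x [y [Xx Xy xy ->]]]] <-].
    by exists (edist x y); [exists x, y | rewrite -e].
  by exists x, y; split; rewrite // e.
apply: card_eq_trans kX; apply: inj_card_eq => r s /set_mem rD /set_mem sD.
have D0 t : distances X t -> 0 <= t by move=> [x [y [_ _ _ ->]]]; exact: sqrtr_ge0.
move=> /(congr1 (fun t => (1 - t) * 2)); rewrite !subKr !divfK ?pnatr_eq0 //.
by move=> /eqP; rewrite eqrXn2 ?D0 // => /eqP.
Qed.

Lemma size_annihilator k X :
  X `<=` usphere -> k_distance_set k X -> size (annihilator X) = k.+1.
Proof.
move=> sX kX; rewrite /annihilator size_prod_XsubC.
by rewrite (card_fset_set (inner_products_card sX kX)).
Qed.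

End Euclidean.

Section Gegenbauer.
Context (R : realType) (d : nat).

(* For (d, l) = (2, 0) the quotient is 0 / 0 = 0, in accordance with the
   convention that this coefficient vanishes at l = 0 *)
Definition gegenbauer_lambda (l : nat) : R := l%:R / (d%:R + 2 * l%:R - 2).

(* The three-term recurrence solved for the polynomial of highest degree; see
   [gegenbauerE] *)
Fixpoint gegenbauer (l : nat) : {poly R} :=
  if l is l1.+1 then
    if l1 is l2.+1 then
      (gegenbauer_lambda l)^-1 *:
        ('X * gegenbauer l1 - (1 - gegenbauer_lambda l2) *: gegenbauer l2)
    else d%:R *: 'X
  else 1.

Context (d_gt0 : (0 < d)%N).

Lemma gegenbauer_lambda_neq0 l : gegenbauer_lambda l.+1 != 0.
Proof.
rewrite /gegenbauer_lambda mulf_neq0 ?invr_neq0 ?pnatr_eq0 //.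
rewrite -[l.+1%:R]natr1 mulrDr mulr1 addrA addrK -natrM -natrD pnatr_eq0.
by rewrite addn_eq0 negb_and -lt0n d_gt0.
Qed.

Lemma gegenbauerE l : (0 < l)%N ->
  'X * gegenbauer l = gegenbauer_lambda l.+1 *: gegenbauer l.+1
    + (1 - gegenbauer_lambda l.-1) *: gegenbauer l.-1.
Proof.
case: l => // l _; rewrite [gegenbauer l.+2]/= scalerA.
by rewrite mulfV ?gegenbauer_lambda_neq0 // scale1r subrK.
Qed.

Lemma size_gegenbauer l : size (gegenbauer l) = l.+1.
Proof.
suff : size (gegenbauer l) = l.+1 /\ size (gegenbauer l.+1) = l.+2 by case.
elim: l => [|l [ih1 ih2]].
  by rewrite size_poly1 size_scale ?size_polyX // pnatr_eq0 -lt0n.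
split=> //; rewrite [gegenbauer l.+2]/=.
rewrite size_scale ?invr_neq0 ?gegenbauer_lambda_neq0 //.
have g0 : gegenbauer l.+1 != 0 by rewrite -size_poly_eq0 ih2.
have sX : size ('X * gegenbauer l.+1) = l.+3.
  by rewrite mulrC size_mulX // ih2.
rewrite size_polyDl sX // size_polyN.
by rewrite (leq_ltn_trans (size_scale_leq _ _)) // ih1.
Qed.

Lemma gegenbauer_expansion k (p : {poly R}) : (size p <= k.+1)%N ->
  exists f : 'I_k.+1 -> R, p = \sum_(i < k.+1) f i *: gegenbauer i.
Proof.
suff H m (q : {poly R}) : (size q <= m)%N ->
  exists f : nat -> R, q = \sum_(i < m) f i *: gegenbauer i.
  by move=> /H[f fE]; exists (fun i => f i).
elim: m q => [|m ih] q sq.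
  by exists (fun=> 0); rewrite big_ord0; apply/eqP; rewrite -size_poly_leq0.
pose c := q`_m / lead_coef (gegenbauer m).
have lc0 : lead_coef (gegenbauer m) != 0.
  by rewrite lead_coef_eq0 -size_poly_eq0 size_gegenbauer.
have /ih[f fE] : (size (q - c *: gegenbauer m)%R <= m)%N.
  apply/leq_sizeP => j mj; rewrite coefB coefZ.
  have [<-|jm] := eqVneq m j.
    by rewrite /c lead_coefE size_gegenbauer /= divfK ?subrr //
      -[X in _`_X]/(m.+1.-1) -size_gegenbauer -lead_coefE.
  have mj' : (m < j)%N by rewrite ltn_neqAle jm.
  rewrite [X in X - _]nth_default ?(leq_trans sq) //.
  by rewrite nth_default ?size_gegenbauer // mulr0 subrr.
exists (fun i => if i == m then c else f i).
rewrite big_ord_recr /= eqxx.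
rewrite (eq_bigr (fun i : 'I_m => f i *: gegenbauer i)); last first.
  by move=> i _; rewrite (ltn_eqF (ltn_ord i)).
by rewrite -fE subrK.
Qed.

End Gegenbauer.

Section Harmonic.
Context (R : realType).

Definition laplacian (d : nat) (p : {mpoly R[d]}) : {mpoly R[d]} :=
  \sum_(i < d) p^`M(i)^`M(i).

Lemma mderiv_homog d i (j : 'I_d) (p : {mpoly R[d]}) :
  p \is i.-homog -> p^`M(j) \is i.-1.-homog.
Proof.
move=> hp; rewrite (mpolyE p) raddf_sum /= big_seq rpred_sum // => m mp.
rewrite mderivZ mderivX rpredZ //.
have [->|mj] := posnP (m j); first by rewrite scale0r rpred0.
rewrite rpredZ // dhomogX -(dhomog_mf hp mp).
have -> : (mdeg m).-1 = mdeg (m - U_(j))%MM.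
  rewrite -{1}(@submK _ U_(j) m) ?mdegD ?mdeg1 ?addn1 //.
  by apply/mnm_lepP => l; rewrite mnm1E; case: eqVneq => [<-|].
by rewrite eqxx.
Qed.

Lemma laplacian_homog d i (p : {mpoly R[d]}) :
  p \is i.-homog -> laplacian p \is i.-2.-homog.
Proof. by move=> hp; rewrite rpred_sum // => j _; do 2!apply: mderiv_homog. Qed.

(* [dhomog d R i] carries a finite-dimensional vector space structure for
   positive d only *)
Context (n i : nat).

Definition laplacian_dhomog (p : dhomog n.+1 R i) : dhomog n.+1 R i.-2 :=
  DHomog (laplacian_homog (dhomog_is_dhomog p)).

Lemma laplacian_dhomog_is_linear : linear laplacian_dhomog.
Proof.
move=> a p q; apply: val_inj; rewrite /= /laplacian scaler_sumr -big_split.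
by apply: eq_bigr => j _ /=; rewrite !(mderivD, mderivZ).
Qed.

HB.instance Definition _ :=
  GRing.isLinear.Build R (dhomog n.+1 R i) (dhomog n.+1 R i.-2) _
    laplacian_dhomog laplacian_dhomog_is_linear.

Definition Harm : {vspace dhomog n.+1 R i} := lker (linfun laplacian_dhomog).

Lemma mem_Harm (p : dhomog n.+1 R i) : (p \in Harm) = (laplacian p == 0).
Proof. by rewrite memv_ker lfunE /= -val_eqE. Qed.

End Harmonic.

(* Main.v *)
Require Import Defs.
From mathcomp Require Import all_boot all_order all_algebra.
From mathcomp Require Import classical_sets cardinality reals.
From HB Require Import structures.
From mathcomp Require Import finmap ring ssrcomplements mpoly.
From mathcomp Require Import boolp functions.
Set Implicit Arguments.
Unset Strict Implicit.
Unset Printing Implicit Defensive.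
Import Order.TTheory GRing.Theory Num.Theory.
Local Open Scope classical_set_scope.
Local Open Scope ring_scope.

(** Why the bound holds.  For a unit vector x, the Gegenbauer polynomial of
    degree l has a homogeneous harmonic extension: a polynomial Z_(l,x) in y
    with Z_(l,x)(y) = G_l((x, y)) on the sphere ([zonal], [laplacian_zonal],
    [meval_zonal]).  The crux is that (Z_(l,x), Z_(l,y)) is a positive multiple,
    independent of x and y, of G_l((x, y)) for a suitable inner product
    ([apolar_zonal]).  So a Gram matrix (G_l((x_i, x_j)))_ij is positive
    semidefinite, and it vanishes on every c such that the combination
    sum_i c_i Z_(l,x_i) is zero.

    The inner product is the apolar (Fischer) pairing of polynomials, which
    replaces integration over the sphere by algebra.  Multiplication by a
    variable is adjoint to differentiation, hence
    - multiplication by |y|^2 is adjoint to the Laplacian, and any multiple of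
      |y|^2 is orthogonal to a harmonic polynomial;
    - (x, y)^l reproduces, up to l!, the value at x of a form of degree l.
    Since Z_(l,x) is a positive multiple of (x, y)^l modulo |y|^2, pairing it
    with the harmonic Z_(l,y) gives the value of Z_(l,y) at x.

    Now let N be the claimed bound, and suppose that X has N+1 distinct points
    x_i.  The N+1 unknowns c_i are more numerous than the linear conditions
    sum_i c_i Z_(l,x_i) = 0, for f_l > 0, as each of these takes place in
    Harm_l; so they have a solution c <> 0 ([common_kernel_neq0]).  Because F_X
    kills the inner products of distinct points,
    F_X(1) sum_i c_i^2 = sum_ij c_i c_j F_X((x_i, x_j))
                       = sum_l f_l sum_ij c_i c_j G_l((x_i, x_j)).
    On the right the terms with f_l > 0 vanish and the others are at most 0;
    but the left-hand side is positive. *)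

(** * The apolar pairing *)

Section Apolar.
Context (R : comNzRingType) (n : nat).
Implicit Types p q : {mpoly R[n]}.

Definition multifact (m : 'X_{1..n}) : nat := \prod_(i < n) (m i)`!.

Definition apolar p q : R :=
  \sum_(m <- msupp p) p@_m * (q@_m * (multifact m)%:R).

(** An index set that does not depend on p makes the symmetry of the pairing
    visible. *)
Lemma apolar_bounded p q k : (msize p <= k)%N ->
  apolar p q = \sum_(m : 'X_{1..n < k}) p@_m * (q@_m * (multifact m)%:R).
Proof.
move=> pk; rewrite /apolar (big_mksub 'X_{1..n < k}) /=; first last.
- by move=> m /msize_mdeg_lt /leq_trans; apply.
- exact: msupp_uniq.
rewrite big_rmcond //= => m /memN_msupp_eq0 ->.
by rewrite mul0r.
Qed.

Lemma apolarC p q : apolar p q = apolar q p.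
Proof.
rewrite (@apolar_bounded p q (maxn (msize p) (msize q))) ?leq_maxl //.
rewrite (@apolar_bounded q p (maxn (msize p) (msize q))) ?leq_maxr //.
by apply: eq_bigr => m _; rewrite mulrCA.
Qed.

Lemma apolar_linearr p : linear_for *%R (apolar p).
Proof.
move=> a q1 q2; rewrite /apolar mulr_sumr -big_split; apply: eq_bigr => m _ /=.
by rewrite mcoeffD mcoeffZ; ring.
Qed.
HB.instance Definition _ p := GRing.isLinear.Build R {mpoly R[n]} R _
  (apolar p) (apolar_linearr p).

Lemma apolarPl a p1 p2 q : apolar (a *: p1 + p2) q = a * apolar p1 q + apolar p2 q.
Proof. by rewrite ![apolar _ q]apolarC linearP. Qed.

Lemma multifactU m i : multifact (U_(i) + m)%MM = ((m i).+1 * multifact m)%N.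
Proof.
rewrite /multifact (bigD1 i) //= [in RHS](bigD1 i) //= mulnA.
congr (_ * _)%N; first by rewrite mnmDE mnm1E eqxx add1n factS.
by apply: eq_bigr => j ji; rewrite mnmDE mnm1E eq_sym (negPf ji) add0n.
Qed.

(** The defining property of the pairing, and the reason for the weights
    m! in it: on monomials, differentiating by the i-th variable brings down the
    factor by which m! and (m + U_i)! differ. *)
Lemma apolarMX i p q : apolar ('X_i * p) q = apolar p q^`M(i).
Proof.
elim/mpolyind: p => [|c m p _ _ ih].
  by rewrite mulr0 ![apolar 0 _]apolarC !linear0.
rewrite mulrDr -scalerAr -mpolyXD !apolarPl ih.
congr (_ * _ + _).
rewrite /apolar !msuppX !big_seq1 !mcoeffX !eqxx !mul1r mcoeff_mderiv.
by rewrite multifactU natrM addmC -[q@__ *+ _]mulr_natr mulrA.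
Qed.
End Apolar.

Lemma apolar_ge0 (R : realDomainType) n (p : {mpoly R[n]}) : 0 <= apolar p p.
Proof. by apply: sumr_ge0 => m _; rewrite mulrA mulr_ge0 // -expr2 sqr_ge0. Qed.

(** * Directional derivatives, Euler's identity and the Laplacian *)

Section Derivations.
Context (R : comNzRingType) (n : nat).
Implicit Types (p q : {mpoly R[n]}) (x : 'rV[R]_n).

Definition linform x : {mpoly R[n]} := \sum_(i < n) x 0 i *: 'X_i.
Definition sqnorm : {mpoly R[n]} := \sum_(i < n) 'X_i ^+ 2.
Definition dirderiv x p : {mpoly R[n]} := \sum_(i < n) x 0 i *: p^`M(i).

Lemma mderivXU (i j : 'I_n) : ('X_j : {mpoly R[n]})^`M(i) = (i == j)%:R.
Proof.
rewrite mderivX mnm1E [j == i]eq_sym; case: eqP => [->|_].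
  rewrite scale1r -[RHS]mpolyX0; congr 'X_[_]; apply/mnmP => l.
  by rewrite mnmBE mnm0E subnn.
by rewrite scale0r.
Qed.

Lemma mderiv_linform x i : (linform x)^`M(i) = (x 0 i)%:MP.
Proof.
rewrite raddf_sum /= (bigD1 i) //= mderivZ mderivXU eqxx big1 ?addr0.
  by rewrite -mul_mpolyC mulr1.
by move=> j ji; rewrite mderivZ mderivXU eq_sym (negPf ji) scaler0.
Qed.

Lemma mderiv_sqnorm i : sqnorm^`M(i) = 2 * 'X_i.
Proof.
rewrite raddf_sum /= (bigD1 i) //= expr2 mderivM !mderivXU eqxx big1 ?addr0.
  by rewrite /=; ring.
by move=> j ji; rewrite expr2 mderivM !mderivXU eq_sym (negPf ji) mul0r mulr0 addr0.
Qed.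

Lemma dirderiv_is_linear x : linear (dirderiv x).
Proof.
move=> a p q; rewrite /dirderiv scaler_sumr -big_split; apply: eq_bigr => i _.
by rewrite mderivD mderivZ scalerDr !scalerA mulrC.
Qed.
HB.instance Definition _ x := GRing.isLinear.Build R {mpoly R[n]} {mpoly R[n]} _
  (dirderiv x) (dirderiv_is_linear x).

Lemma dirderivM x p q : dirderiv x (p * q) = dirderiv x p * q + p * dirderiv x q.
Proof.
rewrite /dirderiv mulr_suml mulr_sumr -big_split; apply: eq_bigr => i _ /=.
by rewrite mderivM scalerDr scalerAl scalerAr.
Qed.

(** Each monomial m occurs once for every i, with weight m_i, and these weights
    add up to its degree. *)
Lemma euler l p : p \is l.-homog -> \sum_(i < n) 'X_i * p^`M(i) = l%:R *: p.
Proof.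
move=> hp.
have E (q : {mpoly R[n]}) : \sum_(i < n) 'X_i * q^`M(i) =
    \sum_(m <- msupp q) (q@_m * (mdeg m)%:R) *: 'X_[m].
  under eq_bigr => i _ do rewrite {1}(mpolyE q) raddf_sum mulr_sumr.
  rewrite exchange_big /=; apply: eq_bigr => m _.
  rewrite mdegE natr_sum mulr_sumr scaler_suml; apply: eq_bigr => i _.
  rewrite mderivZ mderivX scalerA -scalerAr -mpolyXD.
  have [->|mi] := posnP (m i); first by rewrite mulr0 !scale0r.
  by rewrite addmC submK //; apply/mnm_lepP => j; rewrite mnm1E; case: eqVneq => [<-|].
rewrite E [in RHS](mpolyE p) scaler_sumr; apply: eq_big_seq => m mp.
by rewrite scalerA mulrC (dhomog_mf hp mp).
Qed.

Lemma dhomogX1 i : ('X_i : {mpoly R[n]}) \is 1.-homog.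
Proof. by rewrite dhomogX /= mdeg1. Qed.

Lemma linform_homog x : linform x \is 1.-homog.
Proof. by apply: rpred_sum => i _; rewrite rpredZ // dhomogX1. Qed.

Lemma sqnorm_homog : sqnorm \is 2.-homog.
Proof. by apply: rpred_sum => i _; rewrite expr2 (dhomogM (dhomogX1 i) (dhomogX1 i)). Qed.

Lemma apolar_linform x p q : apolar (linform x * p) q = apolar p (dirderiv x q).
Proof.
rewrite mulr_suml apolarC !linear_sum; apply: eq_bigr => i _ /=.
by rewrite linearZ -scalerAl linearZ /= apolarC apolarMX.
Qed.

Lemma dirderiv_linform x :
  dirderiv x (linform x) = (\sum_(i < n) x 0 i ^+ 2)%:MP.
Proof.
rewrite [RHS]raddf_sum /=; apply: eq_bigr => i _.
by rewrite mderiv_linform -mul_mpolyC -mpolyCM expr2.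
Qed.

Lemma dirderiv_sqnorm x : dirderiv x sqnorm = linform x *+ 2.
Proof.
rewrite /linform -sumrMnl; apply: eq_bigr => i _.
by rewrite mderiv_sqnorm -!mul_mpolyC; ring.
Qed.
End Derivations.

Section Laplacian.
Context (R : realType) (n : nat).
Implicit Types (p q : {mpoly R[n]}) (x : 'rV[R]_n).

Lemma dirderiv_homog x l p : p \is l.-homog -> dirderiv x p \is l.-1.-homog.
Proof. by move=> hp; apply: rpred_sum => i _; rewrite rpredZ // mderiv_homog. Qed.

(** The l-th power of the linear form of x reproduces evaluation at x.  Moving
    one factor across the pairing differentiates q in the direction x, and by
    Euler's identity that derivative at x is the degree times q(x). *)
Lemma apolar_linformX x l q :
  q \is l.-homog -> apolar (linform x ^+ l) q = l`!%:R * q.@[x 0].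
Proof.
elim: l q => [|l ih] q hq.
  rewrite expr0 mul1r (_ : q = q@_0%MM *: 1); last first.
    apply/mpolyP => m; rewrite mcoeffZ mcoeff1.
    have [->|m0] := eqVneq m 0%MM; first by rewrite mulr1.
    by rewrite mulr0 (dhomog_nemf_coeff hq) // mdeg_eq0.
  rewrite mevalZ meval1 linearZ /= /apolar msupp1 big_seq1 mcoeff1 eqxx.
  by rewrite /multifact big1 ?mulr1 // => i _; rewrite mnm0E.
rewrite exprS apolar_linform ih; last exact: (dirderiv_homog x hq).
have /(congr1 (meval (x 0))) := euler hq.
rewrite factS natrM mevalZ raddf_sum /= mulrAC => <-.
rewrite mulrC /dirderiv raddf_sum /=; congr (_ * _); apply: eq_bigr => i _.
by rewrite mevalZ mevalM mevalXU.
Qed.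

Lemma apolar_sqnorm p q : apolar (sqnorm R n * p) q = apolar p (laplacian q).
Proof.
rewrite mulr_suml apolarC !linear_sum; apply: eq_bigr => i _ /=.
by rewrite expr2 -mulrA apolarC !apolarMX.
Qed.

Lemma laplacian_is_linear : linear (@laplacian R n).
Proof.
move=> a p q; rewrite /laplacian scaler_sumr -big_split; apply: eq_bigr => i _.
by rewrite !(mderivD, mderivZ).
Qed.
HB.instance Definition _ := GRing.isLinear.Build R {mpoly R[n]} {mpoly R[n]} _
  (@laplacian R n) laplacian_is_linear.

Lemma laplacianM p q : laplacian (p * q) =
  laplacian p * q + (\sum_(i < n) p^`M(i) * q^`M(i)) *+ 2 + p * laplacian q.
Proof.
rewrite /laplacian mulr_suml mulr_sumr -sumrMnl -!big_split /=.
by apply: eq_bigr => i _; rewrite !(mderivM, mderivD); ring.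
Qed.

(** The cross term of the product rule is here a directional derivative. *)
Lemma laplacian_linform x p :
  laplacian (linform x * p) = dirderiv x p *+ 2 + linform x * laplacian p.
Proof.
rewrite laplacianM; congr (_ + _).
rewrite [laplacian _]big1 ?mul0r ?add0r => [|i _]; last first.
  by rewrite mderiv_linform mderivC.
by congr (_ *+ 2); apply: eq_bigr => i _; rewrite mderiv_linform mul_mpolyC.
Qed.

(** The cross term of the product rule is here Euler's operator. *)
Lemma laplacian_sqnorm l p : p \is l.-homog ->
  laplacian (sqnorm R n * p) = (n.*2 + l * 4)%:R *: p + sqnorm R n * laplacian p.
Proof.
move=> hp; rewrite laplacianM; congr (_ + _).
rewrite /laplacian (eq_bigr (fun=> 2%:R)); last first.
  move=> i _; rewrite mderiv_sqnorm mderivM mderivXU eqxx -(mpolyC_nat n R 2).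
  by rewrite mderivC mul0r add0r mulr1.
rewrite sumr_const card_ord (eq_bigr (fun i => 2%:R * ('X_i * p^`M(i)))); last first.
  by move=> i _; rewrite mderiv_sqnorm mulrA.
rewrite -mulr_sumr (euler hp) -!mul_mpolyC !mpolyC_nat.
rewrite -muln2 natrD !natrM; ring.
Qed.
End Laplacian.

(** * Unit vectors *)

Section InnerProduct.
Context (R : realType) (d : nat).
Implicit Types x y : 'rV[R]_d.

Lemma innerC x y : inner x y = inner y x.
Proof. by apply: eq_bigr => i _; rewrite mulrC. Qed.

Lemma inner_ge0 x : 0 <= inner x x.
Proof. by apply: sumr_ge0 => i _; rewrite -expr2 sqr_ge0. Qed.

Lemma inner_gt0 x : x != 0 -> 0 < inner x x.
Proof.
move=> x0; rewrite lt_def inner_ge0 andbT; apply: contra x0.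
rewrite psumr_eq0 => [/allP z|i _]; last by rewrite -expr2 sqr_ge0.
apply/eqP/rowP => i; apply/eqP; rewrite mxE -sqrf_eq0 expr2.
by apply: z; rewrite mem_index_enum.
Qed.

Lemma usphere_inner x : usphere x -> inner x x = 1.
Proof.
move=> nx; rewrite -[LHS]sqr_sqrtr ?inner_ge0 //.
by rewrite -/(enorm x) nx expr1n.
Qed.

Lemma inner_lt1 x y : inner x x = 1 -> inner y y = 1 -> x <> y -> inner x y < 1.
Proof.
move=> xx yy /eqP xy.
have e : inner (x - y) (x - y) = 2 * (1 - inner x y).
  transitivity (inner x x - 2 * inner x y + inner y y); last by rewrite xx yy; ring.
  rewrite /inner mulr_sumr -sumrB -big_split; apply: eq_bigr => i _ /=.
  by rewrite !mxE; ring.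
have := @inner_gt0 (x - y); rewrite subr_eq0 => /(_ xy).
by rewrite e pmulr_rgt0 ?ltr0n // subr_gt0.
Qed.
End InnerProduct.

(** * Zonal harmonics *)

Section Zonal.
Context (R : realType) (d : nat).
Implicit Types (x y : 'rV[R]_d).
Local Notation lambda := (gegenbauer_lambda R d).

(** Gegenbauer's recurrence made homogeneous: t becomes the linear form (x, y),
    and a factor |y|^2, which is 1 on the sphere, restores the degree. *)
Fixpoint zonal x (l : nat) : {mpoly R[d]} :=
  if l is l1.+1 then
    if l1 is l2.+1 then
      (lambda l)^-1 *:
        (linform x * zonal x l1 - (1 - lambda l2) *: (sqnorm R d * zonal x l2))
    else d%:R *: linform x
  else 1.

Arguments zonal x l : simpl never.

Lemma zonalSS x l : zonal x l.+2 = (lambda l.+2)^-1 *: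
  (linform x * zonal x l.+1 - (1 - lambda l) *: (sqnorm R d * zonal x l)).
Proof. by []. Qed.

Lemma gegenbauerSS l : gegenbauer R d l.+2 = (lambda l.+2)^-1 *:
  ('X * gegenbauer R d l.+1 - (1 - lambda l) *: gegenbauer R d l).
Proof. by []. Qed.

Lemma zonal_homog x l : zonal x l \is l.-homog.
Proof.
suff : zonal x l \is l.-homog /\ zonal x l.+1 \is l.+1.-homog by case.
elim: l => [|l [ih1 ih2]].
  by split; [exact: dhomog1 | rewrite /= rpredZ // linform_homog].
split=> //; rewrite zonalSS rpredZ // rpredB ?rpredZ //.
  exact: (dhomogM (linform_homog x) ih2).
exact: (dhomogM (sqnorm_homog R d) ih1).
Qed.

Lemma meval_zonal x y l :
  inner y y = 1 -> (zonal x l).@[y 0] = (gegenbauer R d l).[inner x y].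
Proof.
move=> yy.
have evL : (linform x).@[y 0] = inner x y.
  by rewrite raddf_sum; apply: eq_bigr => i _; rewrite /= mevalZ mevalXU.
have evr : (sqnorm R d).@[y 0] = 1.
  by rewrite raddf_sum -yy; apply: eq_bigr => i _; rewrite /= expr2 mevalM mevalXU.
suff : (zonal x l).@[y 0] = (gegenbauer R d l).[inner x y] /\
  (zonal x l.+1).@[y 0] = (gegenbauer R d l.+1).[inner x y] by case.
elim: l => [|l [ih1 ih2]].
  by rewrite /= mevalZ evL meval1 !hornerE.
split=> //; rewrite zonalSS gegenbauerSS.
rewrite mevalZ mevalB mevalZ !mevalM evL evr ih1 ih2.
by rewrite !hornerE /=; ring.
Qed.

Context (d_gt0 : (0 < d)%N).

Let dn0 (l : nat) : d%:R + 2 * l%:R != 0 :> R.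
Proof. by rewrite -natrM -natrD pnatr_eq0 addn_eq0 negb_and -lt0n d_gt0. Qed.

Lemma gegenbauer_lambdaS l : lambda l.+1 = l.+1%:R / (d%:R + 2 * l%:R).
Proof. by rewrite /gegenbauer_lambda -[l.+1%:R]natr1; congr (_ / _); ring. Qed.

Lemma gegenbauer_lambda_gt0 l : 0 < lambda l.+1.
Proof.
by rewrite gegenbauer_lambdaS divr_gt0 ?ltr0n // lt_def dn0 -natrM -natrD ler0n.
Qed.

Let lambda0 : lambda 0 = 0. Proof. by rewrite /gegenbauer_lambda mul0r. Qed.

(** The pole derivative lowers the degree of a zonal harmonic.  This is what
    makes the Laplacian vanish: applied to the recurrence, the Laplacian leaves
    twice this derivative from the linear form, and Euler's multiple of the
    polynomial two degrees down from |y|^2, and these two cancel. *)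
Lemma dirderiv_zonal x l : inner x x = 1 ->
  dirderiv x (zonal x l.+1) = ((1 - lambda l) * (d%:R + 2 * l%:R)) *: zonal x l.
Proof.
move=> xx.
have DL : dirderiv x (linform x) = 1.
  by rewrite dirderiv_linform (_ : \sum_(i < d) _ = 1) ?mpolyC1.
have D1 : dirderiv x 1 = 0.
  by rewrite /dirderiv big1 // => i _; rewrite -mpolyC1 mderivC scaler0.
pose P l := dirderiv x (zonal x l.+1) =
  ((1 - lambda l) * (d%:R + 2 * l%:R)) *: zonal x l.
suff : P l /\ P l.+1 by case.
elim: l => [|l [ih1 ih2]].
  (* Degrees 1 and 2 are computed directly: the general step below goes back
     three degrees, and the closed form of the coefficients that it uses starts
     at index 1. *)
  have P0 : P 0%N.
    rewrite /P [zonal x 1]/= linearZ /= DL lambda0; congr (_ *: _); ring.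
  split=> //; rewrite /P [zonal x 2]/= linearZ linearB linearZ /=.
  rewrite !dirderivM linearZ /= DL D1 dirderiv_sqnorm lambda0.
  set L := linform x; transitivity (((lambda 2)^-1 * (d%:R *+ 2 - 2)) *: L).
    by rewrite -!mul_mpolyC; ring.
  rewrite scalerA !gegenbauer_lambdaS; congr (_ *: _).
  have d0 : d%:R != 0 :> R by rewrite pnatr_eq0 -lt0n.
  have := dn0 1; rewrite mulr1 => d1.
  by field; rewrite d0.
split=> //; rewrite /P zonalSS linearZ linearB linearZ /=.
rewrite !dirderivM DL dirderiv_sqnorm ih1 ih2.
have := gegenbauer_lambda_gt0 l.+1; rewrite lt0r => /andP[nz2 _].
have rec : linform x * zonal x l.+1 =
    lambda l.+2 *: zonal x l.+2 + (1 - lambda l) *: (sqnorm R d * zonal x l).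
  by rewrite zonalSS scalerA divff // scale1r subrK.
(* The derivative of the recurrence involves the harmonic of degree l+2, the
   linear form times that of degree l+1, and |y|^2 times that of degree l.  The
   recurrence eliminates the second; the third then cancels, and the
   coefficient of the first is a rational identity in l and d. *)
set b := (1 - lambda l) * _; set c := (1 - lambda l.+1) * _.
transitivity ((lambda l.+3)^-1 *: (zonal x l.+2
   + (c - (1 - lambda l.+1) *+ 2) *: (linform x * zonal x l.+1)
   - ((1 - lambda l.+1) * b) *: (sqnorm R d * zonal x l))).
  by rewrite -!mul_mpolyC; ring.
rewrite rec; transitivity (((lambda l.+3)^-1
    * (1 + (c - (1 - lambda l.+1) *+ 2) * lambda l.+2)) *: zonal x l.+2).
  by rewrite -!mul_mpolyC /b /c; ring.
congr (_ *: _); rewrite /c !gegenbauer_lambdaS.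
have := (dn0 l, dn0 l.+1, dn0 l.+2).
rewrite -[l.+3%:R]natr1 -[l.+2%:R]natr1 -[l.+1%:R]natr1 => -[[e0 e1] e2].
have e3 : l%:R + 1 + 1 + 1 != 0 :> R by rewrite !natr1 pnatr_eq0.
by field; rewrite e0 e1 e2.
Qed.

Lemma laplacian_zonal x l : inner x x = 1 -> laplacian (zonal x l) = 0.
Proof.
move=> xx.
suff : laplacian (zonal x l) = 0 /\ laplacian (zonal x l.+1) = 0 by case.
elim: l => [|l [ih1 ih2]].
  split; rewrite /laplacian big1 // => i _; rewrite /= -?mpolyC1 ?mderivC //.
  by rewrite !(mderivZ, mderiv_linform) mderivC scaler0.
split=> //; rewrite zonalSS linearZ linearB linearZ /=.
rewrite laplacian_linform (laplacian_sqnorm (zonal_homog x l)) ih1 ih2.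
rewrite (dirderiv_zonal _ xx) !mulr0 !addr0 scalerA -scaler_nat scalerA -scalerBl.
by rewrite (_ : _ - _ = 0) ?scale0r ?scaler0 // -muln2 natrD !natrM; ring.
Qed.

Definition zonal_lead l : R := \prod_(i < l) (lambda i.+1)^-1.

Lemma zonal_lead_gt0 l : 0 < zonal_lead l.
Proof. by apply: prodr_gt0 => i _; rewrite invr_gt0 gegenbauer_lambda_gt0. Qed.

(** Modulo |y|^2 a step of the recurrence only multiplies by the linear form
    and the inverse of a positive coefficient. *)
Lemma zonal_mod_sqnorm x l : exists q : {mpoly R[d]},
  zonal x l = zonal_lead l *: linform x ^+ l + sqnorm R d * q.
Proof.
case: l => [|l].
  by exists 0; rewrite mulr0 addr0 /zonal_lead big_ord0 scale1r.
elim: l => [|l [q hq]].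
  exists 0; rewrite mulr0 addr0 /zonal_lead big_ord1 expr1 /=.
  by rewrite gegenbauer_lambdaS mulr0 addr0 invf_div divr1.
exists ((lambda l.+2)^-1 *: (linform x * q - (1 - lambda l) *: zonal x l)).
have -> : zonal_lead l.+2 = zonal_lead l.+1 * (lambda l.+2)^-1.
  exact: big_ord_recr.
rewrite zonalSS hq; set w := _^-1; set L := linform x.
by rewrite -!mul_mpolyC mpolyCM !exprS; ring.
Qed.

(** Replace one of the two harmonics by its leading term: the rest is a multiple
    of |y|^2, orthogonal to the other one, and the leading term evaluates it. *)
Lemma apolar_zonal x y l : inner x x = 1 -> inner y y = 1 ->
  apolar (zonal x l) (zonal y l) =
  zonal_lead l * l`!%:R * (gegenbauer R d l).[inner x y].
Proof.
move=> xx yy; have [q ->] := zonal_mod_sqnorm x l.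
rewrite apolarPl apolar_sqnorm laplacian_zonal // linear0 addr0.
by rewrite apolar_linformX ?zonal_homog // meval_zonal // innerC mulrA.
Qed.
End Zonal.

(** * Gram matrices of Gegenbauer polynomials *)

(** Rank-nullity, one map at a time: intersecting with the kernel of a map
    lowers the dimension by at most the rank of that map. *)
Lemma common_kernel_neq0 (K : fieldType) (W : vectType K) (I : finType)
    (V : I -> vectType K) (phi : forall i, 'Hom(W, V i)) (P : pred I) :
  (\sum_(i | P i) \dim (limg (phi i)) < \dim {:W})%N ->
  exists2 w, w != 0 & forall i, P i -> phi i w = 0.
Proof.
move=> lt.
have dimcap (s : seq I) : (\dim {:W} <=
    \dim (\bigcap_(i <- s | P i) lker (phi i)) +
    \sum_(i <- s | P i) \dim (limg (phi i)))%N.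
  elim: s => [|i s ih]; first by rewrite !big_nil addn0.
  rewrite !big_cons; case: (P i) => //; set U := (\bigcap_(_ <- _ | _) _)%VS in ih *.
  rewrite (leq_trans ih) // addnA leq_add2r.
  by rewrite -(limg_ker_dim (phi i) U) capvC leq_add2l dimvS // limgS // subvf.
pose U := (\bigcap_(i | P i) lker (phi i))%VS.
have U0 : (0 < \dim U)%N.
  have := leq_trans lt (dimcap (index_enum I)).
  by rewrite addnC -[X in (X < _)%N]addn0 ltn_add2l.
exists (vpick U); first by rewrite vpick0 -dimv_eq0 -lt0n.
move=> i Pi; apply/eqP; rewrite -memv_ker.
by have := memv_pick U; rewrite /U (bigD1 i) //= => /memv_capP[].
Qed.

Section ZonalMap.
Context (R : realType) (n m : nat) (v : 'I_m -> 'rV[R]_n.+1) (l : nat).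

Definition zonal_comb (c : 'rV[R]_m) : dhomog n.+1 R l :=
  \sum_(i < m) c 0 i *: DHomog (zonal_homog (v i) l).

Lemma zonal_comb_is_linear : linear zonal_comb.
Proof.
move=> a c e; rewrite /zonal_comb scaler_sumr -big_split; apply: eq_bigr => i _.
by rewrite !mxE scalerDl scalerA.
Qed.
HB.instance Definition _ := GRing.isLinear.Build R 'rV[R]_m (dhomog n.+1 R l) _
  zonal_comb zonal_comb_is_linear.

Context (v1 : forall i, inner (v i) (v i) = 1).

Lemma zonal_comb_harm c : zonal_comb c \in Harm R n l.
Proof.
apply: rpred_sum => i _; rewrite rpredZ // mem_Harm /=.
by rewrite laplacian_zonal.
Qed.

Lemma apolar_zonal_comb c : apolar (zonal_comb c) (zonal_comb c) =
  zonal_lead R n.+1 l * l`!%:R * \sum_(i < m) \sum_(j < m)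
     c 0 i * c 0 j * (gegenbauer R n.+1 l).[inner (v i) (v j)].
Proof.
have E : zonal_comb c = \sum_(i < m) c 0 i *: zonal (v i) l :> {mpoly R[n.+1]}.
  by rewrite raddf_sum /=; apply: eq_bigr => i _.
rewrite E linear_sum mulr_sumr; apply: eq_bigr => i _.
rewrite linearZ /= apolarC linear_sum mulr_sumr mulr_sumr; apply: eq_bigr => j _.
by rewrite linearZ /= apolar_zonal //; ring.
Qed.

Let k0 : 0 < zonal_lead R n.+1 l * l`!%:R.
Proof. by rewrite mulr_gt0 ?zonal_lead_gt0 // ltr0n fact_gt0. Qed.

Lemma gegenbauer_form_ge0 (c : 'rV[R]_m) : 0 <= \sum_(i < m) \sum_(j < m)
     c 0 i * c 0 j * (gegenbauer R n.+1 l).[inner (v i) (v j)].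
Proof. by rewrite -(pmulr_rge0 _ k0) -apolar_zonal_comb apolar_ge0. Qed.

Lemma gegenbauer_form_eq0 (c : 'rV[R]_m) : zonal_comb c = 0 ->
  \sum_(i < m) \sum_(j < m)
     c 0 i * c 0 j * (gegenbauer R n.+1 l).[inner (v i) (v j)] = 0.
Proof.
move=> c0; apply/(mulfI (lt0r_neq0 k0)).
by rewrite -apolar_zonal_comb c0 mulr0 linear0.
Qed.
End ZonalMap.

(** * The annihilator polynomial *)

Section Annihilator.
Context (R : realType) (d k : nat) (X : set 'rV[R]_d).
Context (Xs : X `<=` @usphere R d) (Xk : k_distance_set k X).

Lemma mem_inner_products a :
  (a \in fset_set (inner_products X)) = (a \in inner_products X).
Proof.
rewrite in_fset_set //; apply/finite_setP; exists k.
exact: inner_products_card.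
Qed.

Lemma annihilator_eq0 x y : X x -> X y -> x <> y ->
  (annihilator X).[inner x y] = 0.
Proof.
move=> Xx Xy xy; apply/eqP; rewrite -/(root _ _) root_prod_XsubC.
by rewrite mem_inner_products; apply/mem_set; exists x, y.
Qed.

Lemma annihilator1_gt0 : 0 < (annihilator X).[1].
Proof.
rewrite horner_prod big_seq prodr_gt0 // => a.
rewrite mem_inner_products => /set_mem[x [y [Xx Xy xy ->]]].
by rewrite hornerXsubC subr_gt0 inner_lt1 ?usphere_inner //; apply: Xs.
Qed.

Lemma annihilator_form m (v : 'I_m -> 'rV[R]_d) (c : 'rV[R]_m) :
  injective v -> (forall i, X (v i)) ->
  \sum_(i < m) \sum_(j < m) c 0 i * c 0 j * (annihilator X).[inner (v i) (v j)]
  = (annihilator X).[1] * inner c c.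
Proof.
move=> vi vX; rewrite mulr_sumr; apply: eq_bigr => i _.
rewrite (bigD1 i) //= big1 ?addr0 => [|j ji].
  by rewrite (usphere_inner (Xs (vX i))) mulrC.
rewrite annihilator_eq0 ?mulr0 //.
by move=> /vi ij; rewrite ij eqxx in ji.
Qed.
End Annihilator.

(** * The bound *)

Lemma card_le_II_or_inj (T : Type) (A : set T) (N : nat) :
  (A #<= `I_N)%card \/ exists2 v : 'I_N.+1 -> T, injective v & forall i, A (v i).
Proof.
have [le|] := pselect (`I_N.+1 #<= A)%card.
  right; move/card_leP : le => [g].
  pose e (i : 'I_N.+1) : `I_N.+1%classic :=
    SigSub (mem_set (ltn_ord i : `I_N.+1%classic (i : nat))).
  exists (fun i => val (g (e i))) => [i j /val_inj gij|i]; last exact: set_valP.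
  apply/val_inj; have := @inj _ _ _ g (e i) (e j) _ _ gij.
  by rewrite !in_setT => /(_ isT isT)/(congr1 val).
move=> nle; left.
have [/finite_setP[m Am]|/infiniteP inf] := pselect (finite_set A).
  rewrite (card_le_eql Am) card_le_II leqNgt; apply/negP => Nm; apply: nle.
  by rewrite (card_le_eqr Am) card_le_II.
(* An infinite A contains a copy of nat, hence of `I_N.+1. *)
case: nle; apply: card_le_trans inf; exact: subset_card_le.
Qed.

Theorem theorem3p2 (R : realType) (n k : nat) (X : set 'rV[R]_n.+1)
    (f : 'I_k.+1 -> R) :
  X `<=` @usphere R n.+1 ->
  k_distance_set k X ->
  annihilator X = \sum_(i < k.+1) f i *: gegenbauer R n.+1 i ->
  (X #<= `I_(\sum_(i < k.+1 | (0 < f i)%R) \dim (Harm R n i))%N)%card.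
Proof.
move=> Xs Xk XE; set N := (\sum_(i < k.+1 | _) _)%N.
have [//|[v vi vX]] := card_le_II_or_inj X N.
have v1 i : inner (v i) (v i) = 1 by apply/usphere_inner/Xs.
have [|c c0 cker] := @common_kernel_neq0 R 'rV[R]_N.+1 'I_k.+1
    (fun l => dhomog n.+1 R l) (fun l => linfun (zonal_comb v l))
    (fun l => 0 < f l).
  rewrite dimvf /dim /= mul1n ltnS; apply: leq_sum => l _; apply: dimvS.
  by apply/subvP => _ /memv_imgP[c _ ->]; rewrite lfunE zonal_comb_harm.
have : 0 < (annihilator X).[1] * inner c c.
  by rewrite mulr_gt0 ?(annihilator1_gt0 Xs Xk) ?inner_gt0.
rewrite -(annihilator_form Xs Xk c vi vX) ltNge => /negP[].
pose Q l := \sum_(i < N.+1) \sum_(j < N.+1)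
  c 0 i * c 0 j * (gegenbauer R n.+1 l).[inner (v i) (v j)].
(* Expanding the annihilator turns the form into a combination of the Gram
   forms Q l; the choice of c kills those with a positive coefficient. *)
rewrite (_ : \sum_(i < _) _ = \sum_(l < k.+1) f l * Q l).
  apply: sumr_le0 => l _; have [fl|fl] := ltP 0 (f l).
    have := cker l fl; rewrite lfunE /= => /(gegenbauer_form_eq0 v1).
    by rewrite -/(Q l) => ->; rewrite mulr0.
  exact: (mulr_le0_ge0 fl (gegenbauer_form_ge0 l v1 c)).
under [RHS]eq_bigr => l _ do rewrite /Q mulr_sumr.
rewrite [RHS]exchange_big; apply: eq_bigr => i _ /=.
under [RHS]eq_bigr => l _ do rewrite mulr_sumr.
rewrite [RHS]exchange_big; apply: eq_bigr => j _ /=.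
rewrite XE horner_sum mulr_sumr; apply: eq_bigr => l _.
by rewrite hornerZ mulrCA.
Qed.
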